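(* Let $\Sigma=\{a<b<c\}$ and suppose that $w=x\alpha byb\alpha$ and $w'=xb\alpha y\alpha b$ for some $\alpha\in\{a,c\}$ and $x,y\in\Sigma^\ast$. Let $\overline{\alpha}$ be the unique element of $\Sigma\setminus\{\alpha,b\}$. Then $[w]\equiv_M[w']$ if and only if $|x|_{\overline{\alpha}}\,(|y|+|y|_b+3)=|y|_{\overline{\alpha}}\,(|x|+|x|_b+3)$.
   Context: $\Sigma^\ast$ is the set of all finite words over $\Sigma$, including the empty word $\lambda$; juxtaposition denotes concatenation. $|x|$ is the length of the word $x$, and for a letter $d\in\Sigma$, $|x|_d$ is the number of occurrences of $d$ in $x$. $\Sigma=\{a<b<c\}$ denotes an ordered alphabet with three distinct letters and order $a<b<c$. Cyclic shifts: for $w=c_1c_2\cdots c_n$ (letters $c_i$) and $0\le i\le n-1$, the $i$-th cyclic shift of $w$ is $c_{i+1}\cdots c_nc_1\cdots c_i$. The circular word $[w]$ is the set (equivalence class) of all distinct words that are cyclic shifts of $w$ (with $[\lambda]=\{\lambda\}$); $|[w]|$ is its cardinality. Parikh matrix of a linear word: for an ordered alphabet $\Sigma=\{a_1<a_2<\cdots<a_s\}$, $\Psi_\Sigma$ is the monoid morphism from $\Sigma^\ast$ to the $(s+1)\times(s+1)$ matrices under multiplication such that $\Psi_\Sigma(\lambda)$ is the identity matrix and, for $1\le q\le s$, $\Psi_\Sigma(a_q)$ is the matrix with $1$'s on the main diagonal, a $1$ in position $(q,q+1)$, and $0$ elsewhere. Parikh matrix of a circular word: $\Psi_\Sigma([w])=\frac{1}{|[w]|}\sum_{u\in[w]}\Psi_\Sigma(u)$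 (a matrix with rational entries). $M$-equivalence: $[w]\equiv_M[w']$ means $\Psi_\Sigma([w])=\Psi_\Sigma([w'])$. *)

(* Defs.v *)
From mathcomp Require Import all_boot all_order all_algebra finmap.

Set Implicit Arguments.
Unset Strict Implicit.
Unset Printing Implicit Defensive.

Import GRing.Theory.
Local Open Scope ring_scope.
Local Open Scope fset_scope.

(* The ordered alphabet {a_1 < ... < a_s} is 'I_s with its natural order: the
   letter a_q is the ordinal of value q - 1.  Words over it are [seq 'I_s]. *)

(* Row and column indices start at 0, so position (q, q + 1) of a_q becomes
   (q - 1, q). *)
Definition letter_mx (s : nat) (q : 'I_s) : 'M[rat]_s.+1 :=
  1%:M + delta_mx (widen_ord (leqnSn s) q) (lift ord0 q).

Definition parikh_mx (s : nat) (w : seq 'I_s) : 'M[rat]_s.+1 :=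
  \prod_(d <- w) letter_mx d.

(* The shift index ranges over 0 <= i <= n - 1 when the length n is positive,
   and over i = 0 alone when n = 0, so the class of the empty word is
   {empty word}. *)
Definition circular_word (s : nat) (w : seq 'I_s) : {fset seq 'I_s} :=
  [fset rot i w | i in iota 0 (size w).-1.+1].

Definition circular_parikh_mx (s : nat) (C : {fset seq 'I_s}) : 'M[rat]_s.+1 :=
  (#|` C|%:R)^-1 *: \sum_(u <- C) parikh_mx u.

Definition M_equiv (s : nat) (C C' : {fset seq 'I_s}) : Prop :=
  circular_parikh_mx C = circular_parikh_mx C'.

Definition letter_a : 'I_3 := Ordinal (isT : (0 < 3)%N).
Definition letter_b : 'I_3 := Ordinal (isT : (1 < 3)%N).
Definition letter_c : 'I_3 := Ordinal (isT : (2 < 3)%N).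

(* Main.v *)
Require Import Defs.
From mathcomp Require Import all_boot all_order all_algebra finmap.
From mathcomp Require Import ring.

(** Every cyclic shift of w occurs equally often among the n = |w| shifts by
    0, ..., n - 1, so the Parikh matrix of [w] is the plain average of the n
    products Psi(q) Psi(p) over the factorisations w = p q with q nonempty
    ([circular_parikh_mxE]).  As w and w' have the same length, [w] and [w'] are
    M-equivalent iff the sums of these n products agree.

    Write A, B, X, Y for the matrices of alpha, b, x, y, and R_z(M) for the sum
    of Z2 M Z1 over the factorisations z = z1 z2 with z2 nonempty, Zi being the
    matrix of zi ([shift_sum]).  Grouping the shifts by the block where they
    start ([shift_sum_cat]) gives, with u = alpha b and v = b alpha,
      R_w(1)  = R_x(AB Y BA) + R_u(Y BA X) + R_y(BA X AB) + R_v(X AB Y),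
    and R_w'(1) is the same with AB and BA, and u and v, exchanged.

    AB and BA differ only by an elementary matrix two places off the main
    diagonal, because alpha and b are adjacent in the order.  Hence
    AB Y BA - BA Y AB lives in the top right corner, with the value
    |y|_alphabar ([swap_around]).  A matrix supported in that corner is fixed
    under multiplication by unitriangular matrices, so the R_x terms contribute
    |x| |y|_alphabar and, symmetrically, the R_y terms - |y| |x|_alphabar.
    The R_u and R_v terms are eight explicit products, whose difference is again
    in the corner, with the value
      |y|_alphabar (|x|_b + 3) - |x|_alphabar (|y|_b + 3)
    ([shift_sum_swapped_pairs]).  So R_w(1) - R_w'(1) is zero outside the
    corner, and its corner entry vanishes iff the stated identity holds. *)

Set Implicit Arguments.
Unset Strict Implicit.
Unset Printing Implicit Defensive.

Import GRing.Theory Num.Theory.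
Local Open Scope ring_scope.

(** * Averaging over all shifts *)

Lemma parikh_mx_cat s (u v : seq 'I_s) :
  parikh_mx (u ++ v) = parikh_mx u * parikh_mx v.
Proof. exact: big_cat. Qed.

Lemma parikh_mx_cons s d (u : seq 'I_s) :
  parikh_mx (d :: u) = letter_mx d * parikh_mx u.
Proof. exact: big_cons. Qed.

Lemma parikh_mx_nil s : parikh_mx [::] = 1 :> 'M_s.+1.
Proof. exact: big_nil. Qed.

Section CircularMean.
Variables (T : eqType) (w : seq T).

Let shifts := [seq rot i w | i <- iota 0 (size w)].

(** Rotating each shift by one more place only permutes the list of all shifts,
    since the shift by [size w] is the shift by 0 again. *)
Lemma count_mem_shifts_rot1 u : count_mem (rot 1 u) shifts = count_mem u shifts.
Proof.
have shift_perm : perm_eq [seq rot 1 v | v <- shifts] shifts.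
  rewrite /shifts -map_comp.
  have -> : map (rot 1 \o rot^~ w) (iota 0 (size w))
          = map (rot^~ w) (iota 1 (size w)).
    rewrite -[1%N]addn0 iotaDl -map_comp; apply/eq_in_map => i.
    by rewrite mem_iota /= add0n => lt_i; rewrite -(rotS lt_i).
  case: (size w) (rot_size w) => [|n] rot_n //.
  by rewrite -[X in iota 1 X]addn1 iotaD map_cat perm_catC /= add1n rot_n rot0.
rewrite -(permP shift_perm) count_map; apply: eq_count => v /=.
exact: inj_eq (@rot_inj 1 T) v u.
Qed.

Lemma count_mem_shifts_rot i :
  (i <= size w)%N -> count_mem (rot i w) shifts = count_mem w shifts.
Proof.
elim: i => [|i IHi] le_i; first by rewrite rot0.
by rewrite rotS // count_mem_shifts_rot1 IHi // ltnW.
Qed.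

End CircularMean.

(** All elements of the class have the same multiplicity m in the list of the
    n shifts, so n = m |[w]| and both averages agree. *)
Lemma circular_parikh_mxE s (w : seq 'I_s) : (0 < size w)%N ->
  circular_parikh_mx (circular_word w) =
  (size w)%:R^-1 *: \sum_(0 <= i < size w) parikh_mx (rot i w).
Proof.
move=> w_gt0; set shifts := [seq rot i w | i <- iota 0 (size w)].
set m := count_mem w shifts.
have classE : perm_eq (circular_word w) (undup shifts).
  apply: uniq_perm; rewrite ?fset_uniq ?undup_uniq // => u.
  rewrite mem_undup /circular_word prednK //.
  by apply/imfsetP/mapP => -[i iP ->]; exists i.
have sum_shifts (V : nmodType) (F : seq 'I_s -> V) :
    \sum_(u <- shifts) F u = (\sum_(u <- circular_word w) F u) *+ m.
  rewrite (perm_big _ classE) -sumrMnl -big_undup_iterop_count /=.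
  rewrite big_seq [RHS]big_seq; apply: eq_bigr => u.
  rewrite mem_undup => /mapP[i iP ->]; rewrite count_mem_shifts_rot //.
  by move: iP; rewrite mem_iota => /andP[_ /ltnW].
have sizeE : size w = (#|` circular_word w| * m)%N.
  have := sum_shifts nat (fun=> 1%N).
  rewrite !sum1_size size_map size_iota => {1}->.
  by elim: (m) => [|k IHk]; rewrite ?muln0 // mulrS mulnS IHk.
have m_gt0 : (0 < m)%N by move: w_gt0; rewrite sizeE muln_gt0 => /andP[].
have -> : \sum_(0 <= i < size w) parikh_mx (rot i w)
        = \sum_(u <- shifts) parikh_mx u.
  by rewrite big_map /index_iota subn0.
rewrite sum_shifts -scaler_nat scalerA [in RHS]sizeE natrM invfM mulfVK //.
by rewrite pnatr_eq0 -lt0n.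
Qed.

(** The matrix M stands for the rest of the circular word: when w is one block of
    a longer word and M the Parikh matrix of the remaining blocks, read
    cyclically from the end of w, this sums over the shifts starting in w. *)
Definition shift_sum s (w : seq 'I_s) (M : 'M[rat]_s.+1) : 'M[rat]_s.+1 :=
  \sum_(0 <= i < size w) parikh_mx (drop i w) * M * parikh_mx (take i w).

Lemma sum_parikh_mx_rot s (w : seq 'I_s) :
  \sum_(0 <= i < size w) parikh_mx (rot i w) = shift_sum w 1.
Proof. by apply: eq_bigr => i _; rewrite parikh_mx_cat mulr1. Qed.

Lemma shift_sum_cat s (u v : seq 'I_s) M :
  shift_sum (u ++ v) M =
  shift_sum u (parikh_mx v * M) + shift_sum v (M * parikh_mx u).
Proof.
rewrite /shift_sum size_cat (big_cat_nat (leq0n (size u))) ?leq_addr //=; congr (_ + _).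
  apply: eq_big_nat => i /andP[_ lt_i].
  by rewrite drop_cat take_cat lt_i parikh_mx_cat !mulrA.
rewrite -{1}[size u]add0n big_addn addKn; apply: eq_big_nat => i _.
rewrite drop_cat take_cat ltnNge leq_addl /= addnK parikh_mx_cat.
by rewrite !mulrA.
Qed.

Lemma shift_sumB s (w : seq 'I_s) M N :
  shift_sum w (M - N) = shift_sum w M - shift_sum w N.
Proof.
by rewrite -sumrB; apply: eq_bigr => i _; rewrite mulrBr mulrBl.
Qed.

Lemma shift_sum2 s (d e : 'I_s) M :
  shift_sum [:: d; e] M =
  letter_mx d * letter_mx e * M + letter_mx e * M * letter_mx d.
Proof.
by rewrite /shift_sum /= !big_nat_recl // big_nil /= !parikh_mx_cons
  !parikh_mx_nil !mulr1 addr0.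
Qed.

(** * Unitriangular matrices of order 4 *)

(** The arguments p, q, r are the first superdiagonal; d, e, f are the entries at
    (0, 2), (1, 3) and (0, 3). *)
Definition unitri (p q r d e f : rat) : 'M[rat]_4 :=
  \matrix_(i < 4, j < 4) nth 0 (nth [::]
    [:: [:: 1; p; d; f]; [:: 0; 1; q; e]; [:: 0; 0; 1; r]; [:: 0; 0; 0; 1]]
    i) j.

Definition corner : 'M[rat]_4 := delta_mx ord0 ord_max.

Ltac entrywise :=
  apply/matrixP => -[[|[|[|[|//]]]] ?] [[|[|[|[|//]]]] ?];
  rewrite !mxE /= ?big_ord_recl ?big_ord0 ?mxE /=.

Lemma unitriM p q r d e f p' q' r' d' e' f' :
  unitri p q r d e f * unitri p' q' r' d' e' f' =
  unitri (p + p') (q + q') (r + r') (d + d' + p * q') (e + e' + q * r')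
         (f + f' + p * e' + d * r').
Proof. by entrywise; ring. Qed.

Lemma letter_aE : letter_mx letter_a = unitri 1 0 0 0 0 0.
Proof. by entrywise; ring. Qed.

Lemma letter_bE : letter_mx letter_b = unitri 0 1 0 0 0 0.
Proof. by entrywise; ring. Qed.

Lemma letter_cE : letter_mx letter_c = unitri 0 0 1 0 0 0.
Proof. by entrywise; ring. Qed.

Definition letterE := (letter_aE, letter_bE, letter_cE).

Lemma letterP (d : 'I_3) : [\/ d = letter_a, d = letter_b | d = letter_c].
Proof.
case: d => -[|[|[|//]]] lt_d; [apply: Or31|apply: Or32|apply: Or33];
  exact: val_inj.
Qed.

(** The first superdiagonal counts letters; d, e, f count the scattered subwords
    ab, bc, abc.  They are left unspecified because they cancel in every
    comparison below. *)
Lemma parikh_mx_unitri w : exists d e f, parikh_mx w =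
  unitri (count_mem letter_a w)%:R (count_mem letter_b w)%:R
         (count_mem letter_c w)%:R d e f.
Proof.
elim: w => [|l w [d [e [f IHw]]]].
  by exists 0, 0, 0; rewrite parikh_mx_nil; entrywise; ring.
rewrite parikh_mx_cons IHw /=.
by case: (letterP l) => ->; rewrite !letterE unitriM /= !natrD !add0r;
  do 3!eexists; reflexivity.
Qed.

(** Multiplying by the matrix unit at (0, 3) extracts column 0 of the left factor
    and row 3 of the right one, and these are unit vectors. *)
Lemma corner_absorb u v k :
  parikh_mx u * (k *: corner) * parikh_mx v = k *: corner.
Proof.
have [d [e [f ->]]] := parikh_mx_unitri u.
have [d' [e' [f' ->]]] := parikh_mx_unitri v.
have left_fix : unitri (count_mem letter_a u)%:R (count_mem letter_b u)%:R
    (count_mem letter_c u)%:R d e f * (k *: corner) = k *: corner.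
  by entrywise; ring.
by rewrite left_fix; entrywise; ring.
Qed.

Lemma shift_sum_corner w k :
  shift_sum w (k *: corner) = ((size w)%:R * k) *: corner.
Proof.
rewrite /shift_sum; under eq_bigr do rewrite corner_absorb.
by rewrite sumr_const_nat subn0 -scaler_nat scalerA.
Qed.

(** * Exchanging alpha b and b alpha *)

Section Swap.
Variables alpha alphabar : 'I_3.
Hypothesis letters : alpha = letter_a /\ alphabar = letter_c \/
                     alpha = letter_c /\ alphabar = letter_a.

Let A := letter_mx alpha.
Let B := letter_mx letter_b.

(** With K = AB - BA the left side is K Y BA - BA Y K, where K is, up to sign, the
    matrix unit at (0, 2) or (1, 3).  The two products agree at the place of K,
    and the only other entry, at the corner, is the count of alphabar read off
    the superdiagonal of Y. *)
Lemma swap_around y :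
  A * B * parikh_mx y * (B * A) - B * A * parikh_mx y * (A * B) =
  (count_mem alphabar y)%:R *: corner.
Proof.
have [d [e [f ->]]] := parikh_mx_unitri y.
by case: letters => -[eA ->]; rewrite /A /B eA !letterE !unitriM; entrywise; ring.
Qed.

(** Of the shifts starting in one of the exchanged pairs, those starting at its
    first letter contribute |y|_alphabar - |x|_alphabar to the corner, as in
    [swap_around].  Those starting inside it give products such as
    (BYB)(AXA) and (AXA)(BYB), compared with the ones where x and y are
    exchanged; the letters wrapped around x and y turn |x|_b and |y|_b into
    |x|_b + 2 and |y|_b + 2. *)
Lemma shift_sum_swapped_pairs x y :
  shift_sum [:: alpha; letter_b] (parikh_mx y * (B * A) * parikh_mx x)
  + shift_sum [:: letter_b; alpha] (parikh_mx x * (A * B) * parikh_mx y)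
  - (shift_sum [:: letter_b; alpha] (parikh_mx y * (A * B) * parikh_mx x)
     + shift_sum [:: alpha; letter_b] (parikh_mx x * (B * A) * parikh_mx y)) =
  ((count_mem alphabar y)%:R * ((count_mem letter_b x)%:R + 3)
   - (count_mem alphabar x)%:R * ((count_mem letter_b y)%:R + 3)) *: corner.
Proof.
rewrite !shift_sum2.
have [d [e [f ->]]] := parikh_mx_unitri x.
have [d' [e' [f' ->]]] := parikh_mx_unitri y.
case: letters => -[eA ->]; rewrite /A /B eA !letterE !unitriM.
  by entrywise; ring.
by entrywise; ring.
Qed.

(** The equality of the theorem is the vanishing of the scalar on the right.
    The four blocks of both words contribute separately.  The shifts that start
    in x give a fixed matrix sandwiched between factors of x, and the difference
    of the two fixed matrices is a multiple of [corner], which the sandwich does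
    not change; likewise for y.  The two length-2 blocks are treated together. *)
Lemma shift_sum_swap x y :
  shift_sum (x ++ [:: alpha; letter_b] ++ y ++ [:: letter_b; alpha]) 1
  - shift_sum (x ++ [:: letter_b; alpha] ++ y ++ [:: alpha; letter_b]) 1 =
  ((count_mem alphabar y * (size x + count_mem letter_b x + 3))%:R
   - (count_mem alphabar x * (size y + count_mem letter_b y + 3))%:R)
  *: corner.
Proof.
set u := [:: alpha; letter_b]; set v := [:: letter_b; alpha].
have parikh_u : parikh_mx u = A * B.
  by rewrite /u !parikh_mx_cons parikh_mx_nil mulr1.
have parikh_v : parikh_mx v = B * A.
  by rewrite /v !parikh_mx_cons parikh_mx_nil mulr1.
have start_in_x := shift_sum_corner x (count_mem alphabar y)%:R.
have start_in_y := shift_sum_corner y (count_mem alphabar x)%:R.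
rewrite -swap_around shift_sumB in start_in_x.
rewrite -swap_around shift_sumB in start_in_y.
have := shift_sum_swapped_pairs x y; rewrite -/u -/v => start_in_uv.
rewrite !shift_sum_cat !parikh_mx_cat parikh_u parikh_v !mulr1 !mul1r.
rewrite !mulrA in start_in_x start_in_y start_in_uv *.
(* Bring both sums to the order x, y, then the two pairs. *)
rewrite [_ + (shift_sum y _ + _)]addrCA [X in _ - (_ + X)]addrCA.
rewrite opprD addrACA start_in_x opprD addrACA start_in_uv.
rewrite -[shift_sum y _ - _]opprB start_in_y.
rewrite -scaleNr -!scalerDl.
congr (_ *: _); rewrite !natrM !natrD; ring.
Qed.

End Swap.

Theorem theorem5p6 (w w' x y : seq 'I_3) (alpha alphabar : 'I_3)
  (Halpha : alpha \in [set letter_a; letter_c])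
  (Halphabar : alphabar \in [set: 'I_3] :\: [set alpha; letter_b])
  (Hw : w = x ++ [:: alpha; letter_b] ++ y ++ [:: letter_b; alpha])
  (Hw' : w' = x ++ [:: letter_b; alpha] ++ y ++ [:: alpha; letter_b]) :
  M_equiv (circular_word w) (circular_word w') <->
  (count_mem alphabar x * (size y + count_mem letter_b y + 3) =
   count_mem alphabar y * (size x + count_mem letter_b x + 3))%N.
Proof.
have letters : alpha = letter_a /\ alphabar = letter_c \/
               alpha = letter_c /\ alphabar = letter_a.
  move: Halpha Halphabar; rewrite !inE.
  by case: (letterP alphabar) => -> /orP[] /eqP ->; auto.
have w_gt0 : (0 < size w)%N by rewrite Hw !size_cat addnC.
have size_w' : size w' = size w by rewrite Hw Hw' !size_cat.
have n_neq0 : (size w)%:R^-1 != 0 :> rat by rewrite invr_eq0 pnatr_eq0 -lt0n.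
have swap := shift_sum_swap letters x y; rewrite -Hw -Hw' in swap.
have w'_gt0 : (0 < size w')%N by rewrite size_w'.
rewrite /M_equiv !circular_parikh_mxE // !sum_parikh_mx_rot size_w'.
split=> [/(scalerI n_neq0) eq_sums | eq_nat].
  move: swap; rewrite eq_sums subrr => /esym/matrixP/(_ ord0 ord_max).
  rewrite !mxE /= mulr1 => /eqP; rewrite subr_eq0 eqr_nat => /eqP eq_nat.
  exact/esym.
congr (_ *: _); apply/eqP; rewrite -subr_eq0 swap eq_nat subrr.
by rewrite scale0r.
Qed.
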